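(* Let $Z$ be a $d$-dimensional zero-mean stationary Gaussian random field with covariance $\mathbb{E}[Z(\mathbf{x},\cdot)Z(\mathbf{y},\cdot)]=C(\mathbf{x}-\mathbf{y})$, and let $\mathbf{Z}$ be the discrete representation of $Z$ obtained by the circulant embedding method on a uniform grid with discretisation parameters $m_1,\dots,m_d$ of the domain $D=[0,1]^d$. Suppose that the embedding matrix $S\in\mathbb{R}^{s\times s}$, with $s=2^d\prod_{i=1}^d(m_i+J_i)$, is symmetric positive definite upon smooth periodisation with padding parameters $J_1,\dots,J_d\in\mathbb{N}_0$. Let $\tau\in\{1,\dots,s\}$ be the number of smallest eigenvalues of $S$ that are discarded, and let $\tilde{\mathbf{Z}}$ be the resulting smoothed sample. Then, for any $p\in[1,\infty)$, there is a constant $c_p>0$ depending only on $p$ such that $$\mathbb{E}\left[\|\mathbf{Z}-\tilde{\mathbf{Z}}\|_\infty^p\right]\le c_p\, s^{-\frac p2}\left(\Lambda^{\mathrm{ord}}_{s-\tau+1}\right)^{\frac p2}\tau^p .$$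
   Context: Embedding matrix. $C:\mathbb{R}^d\to\mathbb{R}$ is continuous and satisfies $C(\mathbf t)=C(|t_1|,\dots,|t_d|)$. Let $m_i\ge 1$, $J_i\ge 0$ be integers, $n_i=2(m_i+J_i)$, $s=\prod_{i=1}^d n_i$, and $I=\prod_{i=1}^d\{0,\dots,n_i-1\}$ (identified with $\{1,\dots,s\}$ by lexicographic ordering). The uniform grid consists of the points $(p_1/m_1,\dots,p_d/m_d)$, $0\le p_i\le m_i$. The first column of $S$ is the vector $\mathbf s=(\mathbf s_{\mathbf p})_{\mathbf p\in I}$, $$\mathbf s_{\mathbf p}=C^{\mathrm{ext}}\left(\frac{\min(p_1,n_1-p_1)}{m_1},\dots,\frac{\min(p_d,n_d-p_d)}{m_d}\right),$$ and $S_{\mathbf p,\mathbf q}=\mathbf s_{\mathbf r}$ with $r_i=(p_i-q_i)\bmod n_i$ (block circulant with circulant blocks). The principal submatrix of $S$ indexed by $\{\mathbf p: 0\le p_i\le m_i\}$ is the covariance matrix of $Z$ at the grid points. Smooth periodisation. If all $J_i=0$ (no padding), $C^{\mathrm{ext}}=C$. With padding, $\ell=1+J_i/m_i>1$ (the same for all $i$), $\kappa=2\ell-1\ge\ell$, and $\varphi\in C_0^\infty(\mathbb{R})$ is a cutoff function with $\varphi=1$ on $[-1,1]$, $\varphi=0$ on $\mathbb{R}\setminus[-\kappa,\kappa]$ and $\mathrm{supp}(\varphi)=[-\kappa,\kappa]$. Then $$C^{\mathrm{ext}}(\mathbf x)=\sum_{\mathbf n\in\mathbb{Z}^d}(C\varphi_\kappa)(\mathbf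 x+2\ell\mathbf n),\qquad \varphi_\kappa(\mathbf x)=\varphi(\|\mathbf x\|_\infty),$$ so that $C^{\mathrm{ext}}$ is $2\ell$-periodic in each coordinate and equals $C$ on $[-1,1]^d$. An example of such a cutoff is $\varphi(t)=\eta\left(\frac{\kappa-|t|}{\kappa-1}\right)\Big/\left[\eta\left(\frac{\kappa-|t|}{\kappa-1}\right)+\eta\left(\frac{|t|-1}{\kappa-1}\right)\right]$ with $\eta(x)=\exp(-x^{-1})$ for $x>0$ and $\eta(x)=0$ for $x\le0$. Sampling. Let $F\in\mathbb{C}^{s\times s}$ be the unitary $d$-dimensional discrete Fourier matrix, $F_{\mathbf p,\mathbf q}=s^{-1/2}\exp\left(2\pi\mathrm{i}\sum_{i=1}^d p_iq_i/n_i\right)$, and $G=\Re(F)+\Im(F)$. The eigenvalues of $S$ are $\Lambda_{\mathbf q}=(\sqrt s\,F\mathbf s)_{\mathbf q}$, and $S=G\Lambda G^T$ with $\Lambda$ the diagonal matrix of these eigenvalues. $\{\Lambda_j^{\mathrm{ord}}\}_{j=1}^s$ denotes the eigenvalues in non-increasing order, $\Lambda_j^{\mathrm{ord}}=\Lambda_{\pi(j)}$ for a bijection $\pi:\{1,\dots,s\}\to I$. For $\boldsymbol\xi\sim\mathcal N(0,I_s)$, with $I_s$ the $s\times s$ identity matrix, $\mathbf Z=(G\Lambda^{1/2}\boldsymbol\xi)_R$, where $(\cdot)_R$ selects the entries with index $\mathbf p$, $0\le p_i\le m_i$. Smoothing. $\tilde\Lambda$ is the diagonal matrix with $\tilde\Lambda_{\pi(j)}=\Lambda_{\pi(j)}$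 for $j\le s-\tau$ and $\tilde\Lambda_{\pi(j)}=0$ for $j>s-\tau$; $\tilde{\mathbf Z}=(G\tilde\Lambda^{1/2}\boldsymbol\xi)_R$ with the same $\boldsymbol\xi$. *)

(* Defs.v *)
From HB Require Import structures.
From mathcomp Require Import all_boot all_order all_algebra.
From mathcomp Require Import perm complex.
From mathcomp Require Import all_classical all_reals all_analysis.

Set Implicit Arguments.
Unset Strict Implicit.
Unset Printing Implicit Defensive.

Import Order.TTheory GRing.Theory Num.Theory.
Import numFieldNormedType.Exports.

Local Open Scope classical_set_scope.
Local Open Scope ring_scope.

(* [normal_prob m 0] is not the point mass at [m] (it is a uniform law), so the
   degenerate case is treated separately; [normal_prob] takes the standard
   deviation. *)
Definition normal_law (R : realType) (m v : R) : set R -> \bar R :=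
  if 0 < v then normal_prob m (Num.sqrt v) else dirac m.

(* X ~ N(mu, Sigma): every linear combination a X is N(a mu, a Sigma a^T). *)
Definition gaussian_vector (R : realType) (disp : measure_display)
    (T : measurableType disp) (P : probability T R) (n : nat)
    (X : 'I_n -> {RV P >-> R}) (mu : 'cV[R]_n) (Sigma : 'M[R]_n) : Prop :=
  forall (a : 'rV[R]_n) (B : set R), measurable B ->
    P ((fun w => \sum_(k < n) a 0 k * X k w) @^-1` B) =
    normal_law ((a *m mu) 0 0) ((a *m Sigma *m a^T) 0 0) B.

Definition gaussian_field (R : realType) (disp : measure_display)
    (T : measurableType disp) (P : probability T R) (d : nat)
    (D : set 'rV[R]_d) (Z : 'rV[R]_d -> {RV P >-> R}) : Prop :=
  forall (n : nat) (x : 'I_n -> 'rV[R]_d), (forall k, D (x k)) ->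
    exists (mu : 'cV[R]_n) (Sigma : 'M[R]_n),
      gaussian_vector (fun k => Z (x k)) mu Sigma.

Definition zero_mean_with_covariance (R : realType) (disp : measure_display)
    (T : measurableType disp) (P : probability T R) (d : nat)
    (D : set 'rV[R]_d) (Z : 'rV[R]_d -> {RV P >-> R}) (C : 'rV[R]_d -> R)
    : Prop :=
  (forall x, D x -> ('E_P[Z x] = 0)%E) /\
  (forall x y, D x -> D y -> ('E_P[Z x \* Z y] = (C (x - y))%:E)%E).

Definition unit_cube (R : realType) (d : nat) : set 'rV[R]_d :=
  [set x | forall i, 0 <= x 0 i <= 1].

Definition smooth_cutoff (R : realType) (kappa : R) (phi : R -> R) : Prop :=
  [/\ forall (k : nat) (t : R), derivable (derive1n k phi) t 1,
      forall t, -1 <= t <= 1 -> phi t = 1,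
      forall t, ~ (- kappa <= t <= kappa) -> phi t = 0 &
      closure [set t | phi t != 0] = [set t | - kappa <= t <= kappa]].

(* For a compactly supported phi and l > 0 the sum over Z^d has finite support;
   [mx_norm] is the maximum norm. *)
Definition periodisation (R : realType) (d : nat) (l : R) (phi : R -> R)
    (C : 'rV[R]_d -> R) (x : 'rV[R]_d) : R :=
  \sum_(z \in [set: 'rV[int]_d])
    (let y := x + (2 * l) *: map_mx intr z in C y * phi (mx_norm y)).

Definition cov_ext (R : realType) (d : nat) (J : 'I_d -> nat) (l : R)
    (phi : R -> R) (C : 'rV[R]_d -> R) : 'rV[R]_d -> R :=
  if [forall i, J i == 0%N] then C else periodisation l phi C.

Definition ext_dims (d : nat) (m J : 'I_d -> nat) (i : 'I_d) : nat :=
  (2 * (m i + J i))%N.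

Definition num_indices (d : nat) (n : 'I_d -> nat) : nat := (\prod_(i < d) n i)%N.

(* Vectors and matrices are indexed by k < prod_i n_i; [multi_index n k] is the
   k-th element, in lexicographic order, of prod_i {0, ..., n_i - 1}. *)
Definition multi_index (d : nat) (n : 'I_d -> nat) (k : nat) (i : 'I_d) : nat :=
  ((k %/ \prod_(j < d | i < j) n j) %% n i)%N.

Definition circulant_entry (R : realType) (d : nat) (m J : 'I_d -> nat)
    (l : R) (phi : R -> R) (C : 'rV[R]_d -> R) (p : 'I_d -> nat) : R :=
  cov_ext J l phi C
    (\row_(i < d) ((minn (p i) (ext_dims m J i - p i))%N%:R / (m i)%:R)).

Definition first_column (R : realType) (d : nat) (m J : 'I_d -> nat)
    (l : R) (phi : R -> R) (C : 'rV[R]_d -> R)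
    : 'cV[R]_(num_indices (ext_dims m J)) :=
  \col_k circulant_entry m J l phi C (multi_index (ext_dims m J) k).

(* [(p + (n - q)) %% n] is (p - q) mod n for p, q < n. *)
Definition embedding_matrix (R : realType) (d : nat) (m J : 'I_d -> nat)
    (l : R) (phi : R -> R) (C : 'rV[R]_d -> R)
    : 'M[R]_(num_indices (ext_dims m J)) :=
  let n := ext_dims m J in
  \matrix_(k, k') circulant_entry m J l phi C
    (fun i => (multi_index n k i + (n i - multi_index n k' i)) %% n i)%N.

Definition sympos (R : realType) (n : nat) (A : 'M[R]_n) : Prop :=
  A^T = A /\ forall x : 'cV[R]_n, x != 0 -> 0 < (x^T *m A *m x) 0 0.

Definition fourier_matrix (R : realType) (d : nat) (n : 'I_d -> nat)
    : 'M[R[i]]_(num_indices n) :=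
  \matrix_(k, k')
    let theta := 2 * pi * \sum_(i < d)
      (multi_index n k i * multi_index n k' i)%N%:R / (n i)%:R in
    let c := (Num.sqrt (num_indices n)%:R)^-1 in
    (c * cos theta +i* (c * sin theta))%C.

Definition real_fourier_matrix (R : realType) (d : nat) (n : 'I_d -> nat)
    : 'M[R]_(num_indices n) :=
  map_mx (@complex.Re R) (fourier_matrix R n) +
  map_mx (@complex.Im R) (fourier_matrix R n).

(* The vector sqrt(s) F s is real, the first column being invariant under
   p_i |-> (n_i - p_i) mod n_i. *)
Definition embedding_eigenvalue (R : realType) (d : nat) (m J : 'I_d -> nat)
    (l : R) (phi : R -> R) (C : 'rV[R]_d -> R)
    (q : 'I_(num_indices (ext_dims m J))) : R :=
  let n := ext_dims m J in
  complex.Re ((((Num.sqrt (num_indices n)%:R)%:C)%C *: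
    (fourier_matrix R n *m
     map_mx (real_complex R) (first_column m J l phi C))) q 0).

Definition orders_nonincreasing (R : realType) (s : nat) (lambda : 'I_s -> R)
    (pi_ : 'S_s) : Prop :=
  forall j k : 'I_s, (j <= k)%N -> lambda (pi_ k) <= lambda (pi_ j).

(* 1-based: [ordered_eigenvalue lambda pi_ j] is lambda_(pi(j)), 1 <= j <= s,
   the j-th argument of the permutation being the ordinal j - 1. *)
Definition ordered_eigenvalue (R : realType) (s : nat) (lambda : 'I_s -> R)
    (pi_ : 'S_s) (j : nat) : R :=
  nth 0 [seq lambda (pi_ k) | k <- enum 'I_s] j.-1.

Definition smoothed_eigenvalue (R : realType) (s : nat) (lambda : 'I_s -> R)
    (pi_ : 'S_s) (tau : nat) (q : 'I_s) : R :=
  if ((pi_^-1)%g q < s - tau)%N then lambda q else 0.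

Definition grid_indices (d : nat) (m J : 'I_d -> nat)
    : {set 'I_(num_indices (ext_dims m J))} :=
  finset (fun k : 'I_(num_indices (ext_dims m J)) =>
    [forall i, multi_index (ext_dims m J) k i <= m i]%N).

(* (G lambda^(1/2) xi)_R *)
Definition embedding_sample (R : realType) (d : nat) (m J : 'I_d -> nat)
    (lambda : 'I_(num_indices (ext_dims m J)) -> R)
    (xi : 'cV[R]_(num_indices (ext_dims m J))) : 'cV[R]_#|grid_indices m J| :=
  rowsub (@enum_val _ (mem (grid_indices m J)))
    (real_fourier_matrix R (ext_dims m J) *m
     diag_mx (\row_q Num.sqrt (lambda q)) *m xi).

(* Main.v *)
(** The error [Z - ZT] only involves the [tau] discarded eigenvalues, each at
    most [L = Lambda^ord_(s - tau + 1)], and the entries of [G = Re F + Im F] are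
    at most [2 / sqrt s] in absolute value, so pathwise
    [|Z - ZT| <= 2 / sqrt s * sqrt L * sum_q |xi_q|], the sum ranging over the
    discarded indices. The [p]-th power of the sum is at most [tau^p] times the
    average of the [expR (p * |xi_q|)], whose expectations are bounded by a
    constant depending on [p] only, each [xi_q] being standard normal. *)

Require Import Defs.
From HB Require Import structures.
From mathcomp Require Import all_boot all_order all_algebra.
From mathcomp Require Import perm complex.
From mathcomp Require Import all_classical all_reals all_analysis.
From mathcomp Require Import measurable_realfun ring lra.
Import Order.TTheory GRing.Theory Num.Theory.
Import numFieldNormedType.Exports.
Local Open Scope classical_set_scope.
Local Open Scope ring_scope.

(** * Analytic bounds: integrals, normal exponential moments, powers *)

(** The integral of a nonnegative function is a supremum over simple functions below it, so
    monotonicity holds without measurability. The norm of the error is integrated this way. *)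
Lemma ge0_le_integralT (d : measure_display) (T : measurableType d)
    (R : realType) (mu : {measure set T -> \bar R}) (f g : T -> \bar R) :
  (forall x, 0 <= f x)%E -> (forall x, f x <= g x)%E ->
  (\int[mu]_x f x <= \int[mu]_x g x)%E.
Proof.
move=> f0 fg; have g0 x : (0 <= g x)%E by exact: le_trans (f0 x) (fg x).
rewrite !ge0_integralTE//; apply: ereal_sup_le => _ [h hf <-].
by exists h => // x; exact: le_trans (hf x) (fg x).
Qed.

(** The Radon-Nikodym derivative of [normal_prob] and [normal_pdf] have the same integral over every
    measurable set, hence agree almost everywhere. *)
Lemma ge0_integral_normal_prob (R : realType) (m s : R)
    (f : _ -> \bar R) :
  measurable_fun setT f -> (forall x, 0 <= f x)%E ->
  (\int[normal_prob m s]_x f x =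
   \int[lebesgue_measure]_x (f x * (normal_pdf m s x)%:E))%E.
Proof.
move=> mf f0; have nd := normal_prob_dominates m s.
have mpdf : measurable_fun [set: R] (fun x => (normal_pdf m s x)%:E).
  by apply/measurable_EFinP; exact: measurable_normal_pdf.
have mRN := measurable_int _ (Radon_Nikodym_SigmaFinite.f_integrable nd).
rewrite -(Radon_Nikodym_SigmaFinite.change_of_variables nd)//.
apply: ae_eq_integral => //; [exact: emeasurable_funM..|].
apply: ae_eqe_mul2l; apply: integral_ae_eq => //.
  exact: Radon_Nikodym_SigmaFinite.f_integrable.
by move=> A _ mA; rewrite -Radon_Nikodym_SigmaFinite.f_integral.
Qed.

(** Pointwise domination: the integrand times the standard normal density is at most the constant
    times the normal density of standard deviation 2, which has total mass 1. The factor 2 is the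
    ratio of the two peaks. *)
Lemma normal_prob_expR_norm (R : realType) (p : R) :
  (\int[normal_prob 0 1]_x (expR (p * `|x|))%:E <=
   (2 * expR (2 / 3 * p ^+ 2))%:E)%E.
Proof.
rewrite ge0_integral_normal_prob; last 2 first.
- apply/measurable_EFinP; apply: measurableT_comp => //.
  by apply: measurable_funM => //; exact: measurable_normr.
- by move=> x; rewrite lee_fin expR_ge0.
apply: (@le_trans _ _ (\int[lebesgue_measure]_x
    ((2 * expR (2 / 3 * p ^+ 2))%:E * (normal_pdf 0 2 x)%:E))%E); last first.
  rewrite ge0_integralZl//.
  - by rewrite integral_normal_pdf mule1.
  - by apply/measurable_EFinP; exact: measurable_normal_pdf.
  - by move=> x _; rewrite lee_fin normal_pdf_ge0.
apply: ge0_le_integralT => x; rewrite -!EFinM lee_fin.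
  by rewrite mulr_ge0 ?expR_ge0 ?normal_pdf_ge0.
rewrite !normal_pdfE ?pnatr_eq0 ?oner_eq0// /normal_fun.
have -> : normal_peak (2 : R) = 2^-1 * normal_peak 1.
  rewrite /normal_peak -invfM; congr (_^-1).
  have -> : (2 : R) ^+ 2 * pi *+ 2 = 2 ^+ 2 * (1 ^+ 2 * pi *+ 2).
    by rewrite expr1n; ring.
  by rewrite sqrtrM ?sqr_ge0// sqrtr_sqr ger0_norm.
rewrite mulrCA; set E := expR (2 / 3 * _); set k := normal_peak 1.
rewrite [leRHS](_ : _ =
    k * (E * expR (- (x - 0) ^+ 2 / (2 ^+ 2 *+ 2)))); last first.
  by set e := expR _; field.
rewrite -!expRD ler_wpM2l ?normal_peak_ge0// ler_expR.
(* The exponents differ by [(3 |x| - 4 p)^2 / 24]. *)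
rewrite subr0 -(real_normK (num_real x)).
have : 0 <= (3 * `|x| - 4 * p) ^+ 2 by exact: sqr_ge0.
by move: (`|x|) => y; rewrite !expr2; lra.
Qed.

(* With [M] the mean of the [a i]: [M^p <= expR (p M)], because [ln M <= M], and
   [expR] is convex. *)
Lemma powR_sum_le_expR (R : realType) (I : finType) (A : {set I}) (p : R)
    (a : I -> R) : 0 <= p -> (forall i, 0 <= a i) -> (0 < #|A|)%N ->
  (\sum_(i in A) a i) `^ p <=
  #|A|%:R `^ p * (#|A|%:R^-1 * \sum_(i in A) expR (p * a i)).
Proof.
move=> p0 a0 A0; set n : R := #|A|%:R; have n0 : 0 < n by rewrite ltr0n.
set M := n^-1 * \sum_(i in A) a i.
have sumE : \sum_(i in A) a i = n * M by rewrite /M mulVKf ?gt_eqF.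
have M0 : 0 <= M by rewrite mulr_ge0 ?invr_ge0 ?(ltW n0)// sumr_ge0.
rewrite sumE powRM ?(ltW n0)// ler_wpM2l ?powR_ge0//.
apply: (@le_trans _ _ (expR (p * M))).
  (* At base 0, [powR] takes the value 0 or 1 according to [p == 0]; both are at most [expR 0]. *)
  rewrite /powR; case: ifPn => [/eqP ->|M_neq0].
    by rewrite mulr0 expR0; case: (p == 0).
  rewrite ler_expR ler_wpM2l//.
  have lnM := expR_ge1Dx (ln M).
  rewrite lnK ?posrE ?lt0r ?M_neq0// in lnM; lra.
rewrite ler_pdivlMl//.
(* The right side sums the tangent to [expR] at [p * M] over the points [p * a i]; the linear terms
   cancel since [M] is the mean. *)
have -> : n * expR (p * M) =
    \sum_(i in A) expR (p * M) * (1 + (p * a i - p * M)).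
  rewrite -mulr_sumr big_split/= sumr_const sumrB -mulr_sumr sumE sumr_const.
  by rewrite -[1 *+ _]/n -(mulr_natl (p * M)) -/n; ring.
apply: ler_sum => i _; rewrite -[in leRHS](subrKC (p * M) (p * a i)).
by rewrite expRD ler_wpM2l ?expR_ge0// expR_ge1Dx.
Qed.

(** Only an inequality: for negative [x], [Num.sqrt x] is 0 and the left side vanishes, while the
    right side need not. *)
Lemma powR_sqrt_le (R : realType) (p x : R) : 0 < p ->
  Num.sqrt x `^ p <= x `^ (p / 2).
Proof.
move=> p0; have [x0|x0] := leP x 0.
  by rewrite ler0_sqrtr// powR0 ?gt_eqF// powR_ge0.
by rewrite -powR12_sqrt ?(ltW x0)// -powRrM mulrC.
Qed.

(** * Coordinates of a standard Gaussian vector *)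

(** Testing against the [q]-th unit row vector isolates the coordinate; its variance is a diagonal
    entry of the identity, so [normal_law] is in its nondegenerate branch. *)
Lemma gaussian_vector_coord (R : realType) (disp : measure_display)
    (T : measurableType disp) (P : probability T R) (n : nat)
    (X : 'I_n -> {RV P >-> R}) (q : 'I_n) (B : set R) :
  gaussian_vector X 0 1%:M -> measurable B ->
  P (X q @^-1` B) = normal_prob 0 1 B.
Proof.
move=> hX mB; have := hX (delta_mx 0 q) B mB.
rewrite mulmx0 mulmx1 trmx_delta mul_delta_mx !mxE/= /normal_law ltr01 sqrtr1.
have -> // : (fun w => \sum_(k < n) (delta_mx 0 q : 'rV[R]_n) 0 k * X k w) = X q.
apply/funext => w; rewrite (bigD1 q)//= mxE !eqxx mul1r big1 ?addr0// => k kq.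
by rewrite mxE (negbTE kq) andbF mul0r.
Qed.

Lemma gaussian_vector_expR_norm (R : realType) (disp : measure_display)
    (T : measurableType disp) (P : probability T R) (n : nat)
    (X : 'I_n -> {RV P >-> R}) (q : 'I_n) (p : R) :
  gaussian_vector X 0 1%:M ->
  (\int[P]_w (expR (p * `|X q w|))%:E <= (2 * expR (2 / 3 * p ^+ 2))%:E)%E.
Proof.
move=> hX; apply: le_trans (normal_prob_expR_norm R p).
(* [normal_prob] is a measure on [measurableTypeR R], which carries the same
   sigma-algebra as [R] but is a different structure. *)
have mX : measurable_fun setT (X q : T -> measurableTypeR R).
  by move=> _ B mB; exact: (measurable_funP (X q) measurableT B mB).
pose Y : {mfun T >-> measurableTypeR R} :=
  HB.pack (X q : T -> measurableTypeR R) (isMeasurableFun.Build _ _ _ _ _ mX).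
have mf : measurable_fun setT
    (fun x : measurableTypeR R => (expR (p * `|x|))%:E).
  apply/measurable_EFinP; apply: measurableT_comp => //.
  by apply: measurable_funM => //; exact: measurable_normr.
have := @ge0_integral_distribution _ _ _ _ _ P Y _ mf.
rewrite /comp => <-; last by move=> x; rewrite lee_fin expR_ge0.
rewrite (eq_measure_integral (normal_prob 0 1))// => A mA _.
exact: (gaussian_vector_coord _ _ _ P _ X q A hX mA).
Qed.

(** * Pathwise error of the truncated spectrum *)

Lemma real_fourier_matrix_norm_le (R : realType) (d : nat) (n : 'I_d -> nat)
    (i j : 'I_(num_indices n)) :
  `|real_fourier_matrix R n i j| <= 2 / Num.sqrt (num_indices n)%:R.
Proof.
rewrite !mxE/=; set c := _^-1; set t := 2 * pi * _.
have c0 : 0 <= c by rewrite invr_ge0 sqrtr_ge0.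
rewrite -mulrDr normrM (ger0_norm c0) mulrC ler_wpM2r//.
by have := ler_normD (cos t) (sin t); have := cos_max t; have := sin_max t; lra.
Qed.

(** Both samples share [x], so their difference is linear in the differences of the square roots,
    with coefficients from the real Fourier matrix. *)
Lemma embedding_sample_dist (R : realType) (d : nat) (m J : 'I_d -> nat)
    (lam lam' : 'I_(num_indices (ext_dims m J)) -> R)
    (x : 'cV[R]_(num_indices (ext_dims m J))) :
  mx_norm (embedding_sample lam x - embedding_sample lam' x) <=
  2 / Num.sqrt (num_indices (ext_dims m J))%:R *
  \sum_q `|Num.sqrt (lam q) - Num.sqrt (lam' q)| * `|x q 0|.
Proof.
set c := 2 / _; have c0 : 0 <= c by rewrite divr_ge0// sqrtr_ge0.
rewrite mx_normrE; apply: bigmax_le => [|[i j] _ /=].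
  by rewrite mulr_ge0// sumr_ge0// => q _; rewrite mulr_ge0.
rewrite !mxE -sumrB (le_trans (ler_norm_sum _ _ _))// mulr_sumr.
apply: ler_sum => q _; rewrite (ord1 j) !mul_mx_diag !mxE -mulrBl -mulrBr.
rewrite !normrM -mulrA ler_wpM2r//.
by have := real_fourier_matrix_norm_le R _ (ext_dims m J) (enum_val i) q;
  rewrite !mxE.
Qed.

Lemma ordered_eigenvalueE (R : realType) (s : nat) (lam : 'I_s -> R)
    (pi_ : 'S_s) (k : 'I_s) :
  ordered_eigenvalue lam pi_ k.+1 = lam (pi_ k).
Proof.
rewrite /ordered_eigenvalue (nth_map k) ?size_enum_ord; last exact: ltn_ord.
by congr (lam (pi_ _)); exact: nth_ord_enum.
Qed.

Definition discarded (s : nat) (pi_ : 'S_s) (tau : nat) : {set 'I_s} :=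
  [set q | s - tau <= (pi_^-1)%g q]%N%SET.

Lemma card_discarded (s : nat) (pi_ : 'S_s) (tau : nat) :
  (tau <= s)%N -> #|discarded _ pi_ tau| = tau.
Proof.
move=> taus.
have -> : discarded _ pi_ tau =
    ((pi_^-1)%g @^-1: [set k : 'I_s | s - tau <= k]%N)%SET.
  by apply/setP => q; rewrite !inE.
rewrite card_preimset; last exact: perm_inj.
(* Counting goes through the complement, an initial segment of length [s - tau]. *)
have := cardsC [set k : 'I_s | k < s - tau]%N%SET; rewrite card_ord.
have -> : (~: [set k : 'I_s | k < s - tau]%N =
    [set k : 'I_s | s - tau <= k]%N)%SET.
  by apply/setP => q; rewrite !inE -leqNgt.
have -> : #|[set k : 'I_s | k < s - tau]%N%SET| = (s - tau)%N.
  rewrite -sum1_card (eq_bigl (fun k : 'I_s => k < s - tau)%N); last first.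
    by move=> k; rewrite inE.
  by rewrite -(big_ord_widen _ (fun=> 1%N)) ?leq_subr// sum1_card card_ord.
by move=> cE; apply: (@addnI (s - tau)%N); rewrite cE subnK.
Qed.

(** Kept indices contribute 0. A discarded [q] has 0-based rank at least [s - tau], so [lam q] is at
    most the eigenvalue of that rank, whose 1-based rank is [s - tau + 1]. *)
Lemma smoothing_error_sum (R : realType) (s : nat) (lam : 'I_s -> R)
    (pi_ : 'S_s) (tau : nat) (x : 'I_s -> R) :
  orders_nonincreasing lam pi_ -> (1 <= tau <= s)%N ->
  \sum_q `|Num.sqrt (lam q) - Num.sqrt (smoothed_eigenvalue lam pi_ tau q)| *
    `|x q| <=
  Num.sqrt (ordered_eigenvalue lam pi_ (s - tau + 1)) *
  \sum_(q in discarded _ pi_ tau) `|x q|.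
Proof.
move=> hpi /andP[tau0 taus].
have kP : (s - tau < s)%N by rewrite ltn_subrL tau0 (leq_trans tau0).
rewrite mulr_sumr [leRHS]big_mkcond; apply: ler_sum => q _.
rewrite inE /smoothed_eigenvalue; case: ltnP => [_|kq].
  by rewrite subrr normr0 mul0r.
rewrite sqrtr0 subr0 ger0_norm ?sqrtr_ge0// ler_wpM2r// ler_wsqrtr//.
rewrite addn1 (ordered_eigenvalueE _ _ lam pi_ (Ordinal kP)).
by rewrite -{1}(permKV pi_ q); exact: hpi.
Qed.
Theorem theorem1 (R : realType) (p : R) (hp : 1 <= p) :
  exists c : R, 0 < c /\
  forall (d : nat) (hd : (0 < d)%N)
    (C : 'rV[R]_d -> R) (hCcont : continuous C)
    (hCsym : forall t : 'rV[R]_d, C t = C (map_mx Num.norm t))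
    (dispZ : measure_display) (OmegaZ : measurableType dispZ)
    (PZ : probability OmegaZ R) (Zfield : 'rV[R]_d -> {RV PZ >-> R})
    (hZgauss : gaussian_field (@unit_cube R d) Zfield)
    (hZcov : zero_mean_with_covariance (@unit_cube R d) Zfield C)
    (m J : 'I_d -> nat) (hm : forall i, (0 < m i)%N)
    (l : R) (hl : forall i, l = 1 + (J i)%:R / (m i)%:R)
    (phi : R -> R)
    (hphi : ~~ [forall i, J i == 0%N] -> smooth_cutoff (2 * l - 1) phi)
    (hS : sympos (embedding_matrix m J l phi C))
    (disp : measure_display) (Omega : measurableType disp)
    (P : probability Omega R)
    (xi : 'I_(num_indices (ext_dims m J)) -> {RV P >-> R})
    (hxi : gaussian_vector xi 0 1%:M)
    (pi_ : 'S_(num_indices (ext_dims m J)))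
    (hpi : orders_nonincreasing (embedding_eigenvalue l phi C) pi_)
    (tau : nat) (htau : (1 <= tau <= num_indices (ext_dims m J))%N),
  let s := num_indices (ext_dims m J) in
  let Lambda := embedding_eigenvalue l phi C in
  let LambdaT := smoothed_eigenvalue Lambda pi_ tau in
  let Z w := embedding_sample Lambda (\col_q xi q w) in
  let ZT w := embedding_sample LambdaT (\col_q xi q w) in
  ('E_P[fun w => (mx_norm (Z w - ZT w) `^ p)%R] <=
   (c * s%:R `^ (- (p / 2))
      * ordered_eigenvalue Lambda pi_ (s - tau + 1) `^ (p / 2)
      * tau%:R `^ p)%:E)%E.
Proof.
have p0 : 0 < p by lra.
have K0 : 0 < 2 * expR (2 / 3 * p ^+ 2) by rewrite mulr_gt0 ?expR_gt0.
(* The power of 2 comes from the bound on the Fourier entries, the other factor from the exponential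
   moment. *)
exists (2 `^ p * (2 * expR (2 / 3 * p ^+ 2))).
split; first by rewrite mulr_gt0// powR_gt0.
move=> d _ C _ _ ? ? PZ Z0 _ _ m J _ l _ phi _ _ disp Omega P xi hxi pi_ hpi.
move=> tau htau; cbv zeta; set s := num_indices _.
set Lambda := embedding_eigenvalue _ _ _; set LambdaT := smoothed_eigenvalue _ _ _.
pose Z w := embedding_sample Lambda (\col_q xi q w).
pose ZT w := embedding_sample LambdaT (\col_q xi q w).
have [tau0 taus] := andP htau.
have s0 : 0 < s%:R :> R by rewrite ltr0n (leq_trans tau0).
set L := ordered_eigenvalue _ _ _; set K := 2 * expR _ in K0 *.
set D := discarded _ pi_ tau; have cD : #|D| = tau by exact: card_discarded.
(* [b] is the claimed bound without the moment factor [K]. *)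
set b := 2 `^ p * s%:R `^ (- (p / 2)) * L `^ (p / 2) * tau%:R `^ p.
have b0 : 0 <= b by rewrite !mulr_ge0 ?powR_ge0.
have bound w : mx_norm (Z w - ZT w) `^ p <=
    b / tau%:R * \sum_(q in D) expR (p * `|xi q w|).
  set S := \sum_(q in D) `|xi q w|.
  have S0 : 0 <= S by exact: sumr_ge0.
  have norm_le : mx_norm (Z w - ZT w) <= 2 / Num.sqrt s%:R * (Num.sqrt L * S).
    apply: (le_trans (embedding_sample_dist _ _ _ _ _ _ _)).
    rewrite ler_wpM2l ?divr_ge0 ?sqrtr_ge0//.
    under eq_bigr do rewrite mxE.
    exact: smoothing_error_sum.
  have norm0 : 0 <= mx_norm (Z w - ZT w) by rewrite mx_normE.
  apply: (le_trans (ge0_ler_powR (ltW p0) _ _ norm_le)); rewrite ?nnegrE//.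
    by rewrite !mulr_ge0 ?invr_ge0 ?sqrtr_ge0.
  have := powR_sum_le_expR R _ D p (fun q => `|xi q w|) (ltW p0).
  rewrite cD => /(_ (fun _ => normr_ge0 _) tau0) hS.
  rewrite !powRM ?mulr_ge0 ?invr_ge0 ?sqrtr_ge0//.
  have -> : (Num.sqrt s%:R)^-1 `^ p = s%:R `^ (- (p / 2)) :> R.
    rewrite -powR12_sqrt ?(ltW s0)// -powRN -powRrM.
    by congr powR; ring.
  rewrite /b -!mulrA ler_wpM2l ?powR_ge0// ler_wpM2l ?powR_ge0//.
  by rewrite ler_pM ?powR_ge0// powR_sqrt_le.
have mexp q : measurable_fun [set: Omega] (fun w => (expR (p * `|xi q w|))%:E).
  apply/measurable_EFinP; apply: measurableT_comp => //.
  by apply: measurable_funM => //; apply: measurableT_comp.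
rewrite unlock; apply: (@le_trans _ _ (\int[P]_w
    ((b / tau%:R)%:E * \sum_(q <- enum D) (expR (p * `|xi q w|))%:E))%E).
  apply: ge0_le_integralT => w; rewrite ?lee_fin ?powR_ge0//.
  by rewrite sumEFin -EFinM lee_fin big_enum; exact: bound.
have c0 : 0 <= b / tau%:R by rewrite divr_ge0.
rewrite ge0_integralZl//; last 2 first.
- exact: emeasurable_sum.
- by move=> w _; apply: sume_ge0 => q _; rewrite lee_fin expR_ge0.
rewrite ge0_integral_sum//.
apply: (@le_trans _ _ ((b / tau%:R)%:E * \sum_(q <- enum D) K%:E)%E).
  rewrite lee_wpmul2l ?lee_fin//; apply: lee_sum => q _.
  exact: gaussian_vector_expR_norm.
rewrite sumEFin -EFinM lee_fin big_enum sumr_const cD -(mulr_natl K).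
(* The [tau] moment bounds [K] add up to [tau * K], which cancels the division by [tau]. *)
rewrite mulrA divfK ?pnatr_eq0 -?lt0n// /b.
by rewrite le_eqVlt; apply/orP; left; apply/eqP; ring.
Qed.
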